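(* Let $(B,A)$ and $(Q,P)$ be pairs of subspaces in a topological space $X$ such that $B\cap P=\emptyset$ and $A\cap Q=\emptyset$. If $(B,A)$ homologically links $(Q,P)$ in $X$, then $(B,A)$ homotopically links $(Q,P)$.
   Context: Homology is singular homology with coefficients in a fixed field $\mathbb{K}$. A pair $(B,A)$ of subspaces means $A\subset B$. The reduced homology of a pair is $\tilde H_q(B,A)=H_q(B,A)$ if $A\ne\emptyset$ and $\tilde H_q(B,\emptyset)=\tilde H_q(B)$. Homological linking: $(B,A)$ homologically links $(Q,P)$ in $X$ if $(B,A)\subset(X\setminus P,X\setminus Q)$ (i.e. $B\subset X\setminus P$ and $A\subset X\setminus Q$) and this inclusion induces a non-trivial homomorphism $\tilde H_q(B,A)\to\tilde H_q(X\setminus P,X\setminus Q)$ for some $q\ge 0$. Homotopical linking: for pairs with $B\cap P=\emptyset$ and $A\cap Q=\emptyset$, $(B,A)$ homotopically links $(Q,P)$ if for each deformation $\eta:[0,1]\times B\to X$ (a continuous map with $\eta(0,x)=x$ for all $x\in B$) fixing $A$ pointwise (i.e. $\eta(t,x)=x$ for all $t\in[0,1]$, $x\in A$), the following holds: if $\eta(1,B)\cap Q=\emptyset$, then there exists $t\in(0,1]$ with $\eta(t,B)\cap P\neq\emptyset$. *)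

(* Defs.v *)
From HB Require Import structures.
From mathcomp Require Import all_boot all_order all_algebra.
From mathcomp Require Import freeg.
From mathcomp Require Import boolp classical_sets functions reals topology.
From mathcomp Require Import normedtype.

Set Implicit Arguments.
Unset Strict Implicit.
Unset Printing Implicit Defensive.

Import Order.TTheory GRing.Theory Num.Theory numFieldNormedType.Exports.
Local Open Scope classical_set_scope.
Local Open Scope ring_scope.
Local Open Scope quotient_scope.

Section ModuleQuotient.
Context {K : nzRingType} {V : lmodType K} (W : submodClosed V).

(* submodClosed does not inherit from zmodClosed, which Quotient.quot expects. *)
Definition submod_mem : {pred V} := W.

HB.instance Definition _ := GRing.isZmodClosed.Build V submod_mem
  (GRing.subsemimod_closedB (GRing.subsemimodClosedP W)).

Definition module_quot := Quotient.quot submod_mem.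

HB.instance Definition _ := GRing.Zmodule.on module_quot.

Definition quot_pi (v : V) : module_quot := \pi_(Quotient.quot submod_mem) v.

Definition quot_repr (x : module_quot) : V := repr (x : Quotient.quot submod_mem).

Lemma quot_reprK : cancel quot_repr quot_pi.
Proof. exact: (@reprK _ (Quotient.quot submod_mem)). Qed.

Lemma quot_pi_eq u v : (quot_pi u == quot_pi v) = (u - v \in W).
Proof. by rewrite -[RHS]/(u - v \in submod_mem) Quotient.idealrBE. Qed.

Lemma quot_pi_eqP u v : reflect (quot_pi u = quot_pi v) (u - v \in W).
Proof. by rewrite -quot_pi_eq; exact: eqP. Qed.

Lemma quot_piB : {morph quot_pi : u v / u - v}.
Proof. by move=> u v; rewrite /quot_pi !piE. Qed.

Lemma quot_piD : {morph quot_pi : u v / u + v}.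
Proof. by move=> u v; rewrite /quot_pi !piE. Qed.

Definition quot_scale (a : K) (x : module_quot) : module_quot :=
  quot_pi (a *: quot_repr x).

Lemma quot_piZ a v : quot_pi (a *: v) = quot_scale a (quot_pi v).
Proof.
by apply/quot_pi_eqP; rewrite -scalerBr rpredZ// -quot_pi_eq quot_reprK.
Qed.

Lemma quot_scaleA a b x :
  quot_scale a (quot_scale b x) = quot_scale (a * b) x.
Proof. by rewrite -[x]quot_reprK -!quot_piZ scalerA. Qed.

Lemma quot_scale1 : left_id 1 quot_scale.
Proof. by move=> x; rewrite -[x]quot_reprK -quot_piZ scale1r. Qed.

Lemma quot_scaleDr : right_distributive quot_scale +%R.
Proof.
move=> a x y; rewrite -[x]quot_reprK -[y]quot_reprK.
by rewrite -quot_piD -!quot_piZ -quot_piD scalerDr.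
Qed.

Lemma quot_scaleDl x : {morph quot_scale^~ x : a b / a + b}.
Proof.
by move=> a b; rewrite -[x]quot_reprK -!quot_piZ -quot_piD scalerDl.
Qed.

HB.instance Definition _ := GRing.Zmodule_isLmodule.Build K module_quot
  quot_scaleA quot_scale1 quot_scaleDr quot_scaleDl.

Lemma quot_pi_linear : linear quot_pi.
Proof. by move=> a u v; rewrite quot_piD quot_piZ. Qed.

HB.instance Definition _ :=
  GRing.isLinear.Build K V module_quot *:%R quot_pi quot_pi_linear.

Lemma quot_pi_eq0 v : (quot_pi v == 0) = (v \in W).
Proof. by rewrite -(raddf0 quot_pi) quot_pi_eq subr0. Qed.

End ModuleQuotient.

Section ModuleQuotientMap.
Context {K : nzRingType} {V V' : lmodType K}.
Context (W : submodClosed V) (W' : submodClosed V') (f : {linear V -> V'}).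
Context (fW : {in W, forall v, f v \in W'}).

Definition quot_map of {in W, forall v, f v \in W'} :=
  fun x : module_quot W => quot_pi W' (f (quot_repr x)).

Lemma quot_map_pi v : quot_map fW (quot_pi W v) = quot_pi W' (f v).
Proof.
by apply/quot_pi_eqP; rewrite -raddfB fW// -quot_pi_eq quot_reprK.
Qed.

Lemma quot_map_linear : linear (quot_map fW).
Proof.
move=> a x y; rewrite -[x]quot_reprK -[y]quot_reprK.
by rewrite -linearP !quot_map_pi !linearP.
Qed.

HB.instance Definition _ := GRing.isLinear.Build K (module_quot W)
  (module_quot W') *:%R (quot_map fW) quot_map_linear.

End ModuleQuotientMap.

Section FreeModule.
Context {K : nzRingType} {T : choiceType} {M : lmodType K} (f : T -> M).

Lemma fglift_linear : linear (fglift f).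
Proof.
have fgliftB := lift_is_additive f.
have fglift0 : fglift f 0 = 0 by rewrite -(subrr 0) fgliftB subrr.
have fgliftN u : fglift f (- u) = - fglift f u.
  by rewrite -sub0r fgliftB fglift0 sub0r.
have fgliftD u v : fglift f (u + v) = fglift f u + fglift f v.
  by rewrite -[v in LHS]opprK fgliftB fgliftN opprK.
have fglift_sum (s : seq T) (c : T -> K) :
    fglift f (\sum_(x <- s) << c x *g x >>) = \sum_(x <- s) c x *: f x.
  by elim/big_ind2: _ => // [_ u _ v <- <-|x _]; rewrite ?fgliftD ?liftU.
move=> a u v; rewrite fgliftD; congr (_ + _).
rewrite -[in RHS](freeg_sumE u) [a *: u]/(fgscale a u) /fgscale !fglift_sum.
by rewrite scaler_sumr; apply: eq_bigr => x _; rewrite scalerA.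
Qed.

HB.instance Definition _ := GRing.isLinear.Build K {freeg T / K} M *:%R
  (fglift f) fglift_linear.

Lemma fglift1 x : fglift f << x >> = f x.
Proof. by rewrite liftU scale1r. Qed.

Lemma freegUE (a : K) (x : T) : << a *g x >> = a *: << x >>.
Proof. by apply/eqP/freeg_eqP => y; rewrite coeffZ !coeffU mul1r. Qed.

Lemma freeg_linear_ext (g h : {freeg T / K} -> M) :
  linear g -> linear h -> (forall x, g << x >> = h << x >>) -> g =1 h.
Proof.
move=> gL hL gh c.
pose gP := GRing.isLinear.Build _ _ _ _ g gL.
pose hP := GRing.isLinear.Build _ _ _ _ h hL.
pose g' : {linear _ -> _} := HB.pack g gP.
pose h' : {linear _ -> _} := HB.pack h hP.
change (g' c = h' c).
rewrite -(freeg_sumE c) !linear_sum; apply: eq_bigr => x _.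
by rewrite freegUE !linearZ /= gh.
Qed.

End FreeModule.

Section StandardSimplex.
Context (R : realType).

Definition standard_simplex (q : nat) : set 'rV[R]_q.+1 :=
  [set x | (forall i, 0 <= x 0 i) /\ \sum_i x 0 i = 1].

Arguments standard_simplex : clear implicits.

(* The affine map onto the i-th face: insert a zero coordinate at i. *)
Definition face_row (q : nat) (i : 'I_q.+2) (x : 'rV[R]_q.+1) : 'rV[R]_q.+2 :=
  \row_j oapp (x 0) 0 (unlift i j).

Lemma face_row_simplex q (i : 'I_q.+2) x :
  standard_simplex q x -> standard_simplex q.+1 (face_row i x).
Proof.
move=> [x_ge0 x1]; split=> [j|].
  by rewrite mxE; case: (unlift i j) => /=.
rewrite (bigD1_ord i)//= mxE unlift_none/= add0r -[RHS]x1.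
by apply: eq_bigr => j _; rewrite mxE liftK.
Qed.

Definition face_fun (q : nat) (i : 'I_q.+2) (x : standard_simplex q) :
    standard_simplex q.+1 :=
  exist _ (face_row i (val x)) (mem_set (face_row_simplex i (set_valP x))).

Lemma face_row_continuous q (i : 'I_q.+2) : continuous (@face_row q i).
Proof.
move=> x A [U Ux sU].
suff nU j : \forall y \near x, U 0 j (face_row i y 0 j).
  have : \forall y \near x, forall j, U 0 j (face_row i y 0 j).
    exact: (@filter_forall _ _ (fun j y => U 0 j (face_row i y 0 j)) _ _ nU).
  by apply: filterS => y Uy; apply: sU => k j; rewrite (ord1 k).
have := Ux 0 j; rewrite !mxE.
case E : (unlift i j) => [k|] /= Uxj; last first.
  have U0 := nbhs_singleton Uxj.
  by apply: filterE => y; rewrite mxE E.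
have : \forall y \near x, U 0 j ((y : 'rV[R]_q.+1) 0 k).
  by exact: coord_continuous Uxj.
by apply: filterS => y; rewrite mxE E.
Qed.

Lemma face_continuous q (i : 'I_q.+2) : continuous (@face_fun q i).
Proof.
have cf : continuous (set_val \o @face_fun q i).
  move=> x; apply: (@continuous_comp _ _ _ set_val (@face_row q i)).
    exact: initial_continuous.
  exact: face_row_continuous.
exact: (@continuous_comp_initial _ _ _ set_val (@face_fun q i) cf).
Qed.

Definition face (q : nat) (i : 'I_q.+2) :
    continuousType (standard_simplex q) (standard_simplex q.+1) :=
  mkcts (@face_continuous q i).

End StandardSimplex.

Arguments standard_simplex : clear implicits.

Notation singular_simplex R T q :=
  (continuousType (set_type (standard_simplex R q)) T).

Notation chain R K T q := {freeg (singular_simplex R T q) / K}.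

Section Chains.
Context (R : realType) (K : fieldType) (T : topologicalType).

Definition boundary (q : nat) : chain R K T q.+1 -> chain R K T q :=
  fglift (fun s : singular_simplex R T q.+1 =>
    \sum_(i < q.+2)
      (-1) ^+ i *: << (s \o face R i : singular_simplex R T q) >>).

HB.instance Definition _ q := GRing.Linear.on (@boundary q).

(* The sum of the coefficients. *)
Definition augmentation : chain R K T 0 -> K^o := fglift (fun=> 1 : K^o).

HB.instance Definition _ := GRing.Linear.on augmentation.

Definition chain_in (q : nat) (A : set T) (c : chain R K T q) : Prop :=
  forall s, s \in dom c -> range s `<=` A.

Lemma chain_in0 q A : @chain_in q A 0.
Proof. by move=> s; rewrite dom0. Qed.

Lemma chain_inP q A a (u v : chain R K T q) :
  chain_in A u -> chain_in A v -> chain_in A (a *: u + v).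
Proof.
move=> Au Av s /domD_subset; rewrite mem_cat => /orP[/domZ_subset|].
  exact: Au.
exact: Av.
Qed.

(* A relative cycle is a chain whose boundary lies in A. The extra condition in
   degree 0, vacuous unless A is empty, is that of the augmented chain complex.
   So the homology below is the ordinary relative homology of (T, A) when A is
   nonempty, and the reduced homology of T when A is empty. *)
Definition is_reduced_cycle (q : nat) (A : set T) : chain R K T q -> Prop :=
  match q return chain R K T q -> Prop with
  | 0 => fun c => A = set0 -> augmentation c = 0
  | _.+1 => fun c => chain_in A (boundary c)
  end.

Definition reduced_cycle_pred q A : {pred chain R K T q} :=
  fun c => `[< is_reduced_cycle A c >].

Lemma reduced_cycle_pred_submod q A :
  subsemimod_closed (reduced_cycle_pred (q := q) A).
Proof.
apply: GRing.submod_closed_semi; split.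
  apply/asboolP; case: q => [|q] /=; first by rewrite linear0.
  by rewrite linear0; exact: chain_in0.
move=> a u v /asboolP Au /asboolP Av; apply/asboolP.
case: q u v Au Av => [|q] u v /= Au Av.
  by move=> A0; rewrite linearP /= Au// Av// scaler0 addr0.
by rewrite linearD linearZ /=; exact: chain_inP.
Qed.

HB.instance Definition _ q A := GRing.isSubmodClosed.Build K (chain R K T q)
  (@reduced_cycle_pred q A) (@reduced_cycle_pred_submod q A).

Record reduced_cycle q A := ReducedCycle {
  reduced_cycle_chain :> chain R K T q;
  reduced_cycleP : reduced_cycle_chain \in reduced_cycle_pred A }.

HB.instance Definition _ q A := [isSub for @reduced_cycle_chain q A].
HB.instance Definition _ q A := [Choice of reduced_cycle q A by <:].
HB.instance Definition _ q A :=
  [SubChoice_isSubLmodule of reduced_cycle q A by <:].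

(* z is a boundary in the quotient of the chains of T by the chains of A. *)
Definition is_relative_boundary q A (z : reduced_cycle q A) : Prop :=
  exists b : chain R K T q.+1, exists2 a : chain R K T q,
    chain_in A a & (z : chain R K T q) = boundary b + a.

Definition relative_boundary_pred q A : {pred reduced_cycle q A} :=
  fun z => `[< is_relative_boundary z >].

Lemma relative_boundary_pred_submod q A :
  subsemimod_closed (@relative_boundary_pred q A).
Proof.
apply: GRing.submod_closed_semi; split.
  apply/asboolP; exists 0, 0; first exact: chain_in0.
  by rewrite linear0 addr0.
move=> a u v /asboolP[b [c Ac uE]] /asboolP[b' [c' Ac' vE]]; apply/asboolP.
exists (a *: b + b'), (a *: c + c'); first exact: chain_inP.
by rewrite linearP /= uE vE scalerDr addrACA.
Qed.

HB.instance Definition _ q A := GRing.isSubmodClosed.Build K (reduced_cycle q A)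
  (@relative_boundary_pred q A) (@relative_boundary_pred_submod q A).

Definition reduced_homology q A : lmodType K :=
  module_quot (@relative_boundary_pred q A).

End Chains.

Section InducedMap.
Context (R : realType) (K : fieldType) (T T' : topologicalType).
Context (A : set T) (A' : set T') (f : continuousType T T').

Definition chain_map (q : nat) : chain R K T q -> chain R K T' q :=
  fglift (fun s : singular_simplex R T q =>
    << (f \o s : singular_simplex R T' q) >>).

HB.instance Definition _ q := GRing.Linear.on (@chain_map q).

Lemma chain_map1 q (s : singular_simplex R T q) :
  chain_map << s >> = << (f \o s : singular_simplex R T' q) >>.
Proof. exact: fglift1. Qed.

Lemma boundary_map q (c : chain R K T q.+1) :
  boundary (chain_map c) = chain_map (boundary c).
Proof.
move: c; apply: freeg_linear_ext => [a u v|a u v|s].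
- by rewrite !(linearD, linearZ).
- by rewrite !(linearD, linearZ).
rewrite /boundary chain_map1 !fglift1 linear_sum; apply: eq_bigr => i _.
rewrite linearZ /= chain_map1; congr (_ *: << _ >>).
exact/continuousEP.
Qed.

Lemma augmentation_map (c : chain R K T 0) :
  augmentation (chain_map c) = augmentation c.
Proof.
move: c; apply: freeg_linear_ext => [a u v|a u v|s].
- by rewrite !(linearD, linearZ).
- by rewrite !(linearD, linearZ).
by rewrite chain_map1 /augmentation !fglift1.
Qed.

Context (fA : f @` A `<=` A').

Lemma chain_in_map q (c : chain R K T q) :
  chain_in A c -> chain_in A' (chain_map c).
Proof.
rewrite -[X in chain_map X]freeg_sumE linear_sum => Ac.
have : forall s, s \in dom c -> s \in dom c by [].
elim: {1 3}(dom c) => [|s l IHl] sub; first by rewrite big_nil; exact: chain_in0.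
rewrite big_cons freegUE linearZ /= chain_map1; apply: chain_inP; last first.
  by apply: IHl => s' s'l; apply: sub; rewrite in_cons s'l orbT.
move=> s'; rewrite domU1 inE => /eqP -> _ [x _ <-] /=.
apply: fA; exists (s x) => //; apply: (Ac s); last by exists x.
by apply: sub; rewrite mem_head.
Qed.

Lemma is_reduced_cycle_map q (c : chain R K T q) :
  is_reduced_cycle A c -> is_reduced_cycle A' (chain_map c).
Proof.
case: q c => [|q] c /= Ac; last by rewrite boundary_map; exact: chain_in_map.
move=> A'0; rewrite augmentation_map Ac//.
by move: fA; rewrite A'0 subset0; exact: image_set0_set0.
Qed.

Definition reduced_cycle_map q (z : reduced_cycle R K q A) :
    reduced_cycle R K q A' :=
  ReducedCycle (introT (asboolP _)
    (is_reduced_cycle_map (elimT (asboolP _) (reduced_cycleP z)))).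

Lemma reduced_cycle_map_linear q : linear (@reduced_cycle_map q).
Proof. by move=> a u v; apply: val_inj; rewrite /= linearP. Qed.

HB.instance Definition _ q := GRing.isLinear.Build K (reduced_cycle R K q A)
  (reduced_cycle R K q A') *:%R (@reduced_cycle_map q) (@reduced_cycle_map_linear q).

Lemma relative_boundary_pred_map q : {in @relative_boundary_pred R K T q A, forall z,
  reduced_cycle_map z \in @relative_boundary_pred R K T' q A'}.
Proof.
move=> z /asboolP[b [a Aa zE]]; apply/asboolP.
exists (chain_map b), (chain_map a); first exact: chain_in_map.
by rewrite /= zE linearD boundary_map.
Qed.

Definition reduced_homology_map q :
    {linear reduced_homology R K q A -> reduced_homology R K q A'} :=
  quot_map (@relative_boundary_pred_map q).

End InducedMap.

Arguments reduced_homology_map R K {T T' A A'} f fA q.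

Section Linking.
Context {X : topologicalType}.

Section Inclusion.
Context (B D : set X) (BD : B `<=` D).

Definition inclusion_fun (x : B) : D :=
  exist _ (val x) (mem_set (BD (set_valP x))).

Lemma inclusion_continuous : continuous inclusion_fun.
Proof.
apply: (@continuous_comp_initial _ _ _ set_val inclusion_fun).
exact: initial_continuous.
Qed.

Definition inclusion : continuousType B D := mkcts inclusion_continuous.

Lemma inclusion_pair (A C : set X) : A `<=` C ->
  inclusion @` (val @^-1` A) `<=` (val @^-1` C).
Proof. by move=> sAC _ [x Ax <-]; exact: sAC. Qed.

End Inclusion.

Arguments inclusion {B D} BD.
Arguments inclusion_pair {B D} BD {A C}.

(* Subspaces are subset types with the induced topology, so the pair (B, A) of
   subspaces of X is the space B together with the trace of A on it. *)
Definition homologically_links (R : realType) (K : fieldType)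
    (B A Q P : set X) : Prop :=
  exists (BP : B `<=` ~` P) (AQ : A `<=` ~` Q) (q : nat)
      (z : reduced_homology R K q (val @^-1` A : set B)),
    reduced_homology_map R K (inclusion BP) (inclusion_pair BP AQ) q z != 0.

(* A map on [0, 1] x B is given by a total function on R * X of which only
   the restriction to [0, 1] x B matters; any map on [0, 1] x B extends to one,
   for instance by the second projection. *)
Definition deformation (R : realType) (B : set X) (eta : R * X -> X) : Prop :=
  {within (`[0, 1] `*` B), continuous eta} /\
  forall x, B x -> eta (0, x) = x.

Definition homotopically_links (R : realType) (B A Q P : set X) : Prop :=
  forall eta : R * X -> X, deformation B eta ->
  (forall (t : R) x, t \in `[0, 1] -> A x -> eta (t, x) = x) ->
  (fun x => eta (1, x)) @` B `&` Q = set0 ->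
  exists2 t : R, t \in `]0, 1] & (fun x => eta (t, x)) @` B `&` P !=set0.

End Linking.

(* Main.v *)
From HB Require Import structures.
Require Import Defs.
From mathcomp Require Import freeg.
From mathcomp Require Import all_boot all_order all_algebra.
From mathcomp Require Import boolp classical_sets functions reals topology.
From mathcomp Require Import normedtype.
From mathcomp Require Import zify.

Set Implicit Arguments.
Unset Strict Implicit.
Unset Printing Implicit Defensive.

Import Order.TTheory GRing.Theory Num.Theory numFieldNormedType.Exports.
Local Open Scope ring_scope.
Local Open Scope classical_set_scope.

(** Suppose that a deformation eta of B in X fixes A, ends outside Q and never
meets P. At time 0 it is the inclusion of B, which avoids P as well, so eta is
a homotopy of maps from B to the complement of P, starting at the inclusion.
It keeps A inside the complement of Q at all times, because it does not move A.
By homotopy invariance ([reduced_homology_map_homotopic]) the inclusion of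
(B, A) into (X \ P, X \ Q) induces the same map in homology as the end map of
eta. The end map sends all of B into X \ Q, so every chain that it carries is
zero relative to X \ Q and it induces zero ([reduced_homology_map_eq0]). Hence
the inclusion induces zero in every degree, and (B, A) does not homologically
link (Q, P).

Homotopy invariance rests on the prism operator, a chain homotopy between the
maps induced by the two ends of a homotopy h ([boundary_prism0],
[boundary_prismS]). All the simplices that occur in it and in its boundary have
the same form: they are composites of h with an affine map from a simplex to the
prism (standard simplex times [0, 1]) that sends vertices to vertices. Such a
map is given by the vertex f k of the base under the image of the vertex k, and
by the set P of those k that go to the top. Taking faces then amounts to
composing f and P with maps of ordinals, so that all the identities between
faces of prisms become arithmetic of [bump] and [unbump]; the signs are handled
once and for all, in an arbitrary module, by [alternating_prism_sum]. *)

(** * Affine maps between standard simplices *)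

Section AffineMaps.
Context (R : realType).

Lemma row_continuous (T : topologicalType) n (g : T -> 'rV[R]_n) :
  (forall j, continuous (fun x => g x 0 j)) -> continuous g.
Proof.
move=> cg x A [U Ux sU].
have : \forall y \near x, forall j, U 0 j (g y 0 j).
  apply: (@filter_forall _ _ (fun j y => U 0 j (g y 0 j))) => j.
  exact: (cg j x _ (Ux 0 j)).
by apply: filterS => y Uy; apply: sU => k j; rewrite (ord1 k).
Qed.

Lemma sum_coord_continuous n (P : pred 'I_n) :
  continuous (fun x : 'rV[R]_n => \sum_(k | P k) x 0 k).
Proof.
apply: (@continuous_big R^o) => [|k _]; last exact: coord_continuous.
exact: add_continuous.
Qed.

(** In barycentric coordinates, this is the linear map that sends the k-th
vertex to the vertex f k. *)
Definition push_row m n (f : 'I_m -> 'I_n) (x : 'rV[R]_m) : 'rV[R]_n :=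
  \row_j \sum_(k | f k == j) x 0 k.

Lemma sum_push_row m n (f : 'I_m -> 'I_n) (P : pred 'I_n) x :
  \sum_(j | P j) push_row f x 0 j = \sum_(k | P (f k)) x 0 k.
Proof.
rewrite [RHS](partition_big f P) //=; apply: eq_bigr => j Pj.
rewrite mxE; apply: eq_bigl => k.
by case: eqP => [->|]; rewrite ?Pj ?andbF.
Qed.

Lemma push_row_simplex m n (f : 'I_m.+1 -> 'I_n.+1) x :
  standard_simplex R m x -> standard_simplex R n (push_row f x).
Proof.
move=> [x_ge0 x1]; split=> [j|]; first by rewrite mxE sumr_ge0.
by rewrite sum_push_row.
Qed.

Definition push_fun m n (f : 'I_m.+1 -> 'I_n.+1) (x : standard_simplex R m) :
    standard_simplex R n :=
  exist _ (push_row f (val x)) (mem_set (push_row_simplex f (set_valP x))).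

Lemma push_continuous m n (f : 'I_m.+1 -> 'I_n.+1) : continuous (push_fun f).
Proof.
apply: (@continuous_comp_initial _ _ _ set_val (push_fun f)) => x.
apply: (@continuous_comp _ _ _ set_val (@push_row _ _ f)).
  exact: initial_continuous.
apply: row_continuous => j.
rewrite (_ : (fun _ => _) = fun y : 'rV_ _ => \sum_(k | f k == j) y 0 k).
  exact: sum_coord_continuous.
by apply/funext => y; rewrite mxE.
Qed.

Definition push m n (f : 'I_m.+1 -> 'I_n.+1) :
    continuousType (standard_simplex R m) (standard_simplex R n) :=
  mkcts (@push_continuous m n f).

Lemma push_comp l m n (f : 'I_m.+1 -> 'I_n.+1) (g : 'I_l.+1 -> 'I_m.+1) x :
  push f (push g x) = push (f \o g) x.
Proof.
by apply: val_inj; apply/rowP => j; rewrite /= mxE sum_push_row !mxE.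
Qed.

Lemma push_id n x : push (@id 'I_n.+1) x = x.
Proof. by apply: val_inj; apply/rowP => j; rewrite !mxE big_pred1_eq. Qed.

Lemma face_push n (i : 'I_n.+2) x : face R i x = push (lift i) x.
Proof.
apply: val_inj; apply/rowP => j; rewrite !mxE.
case: unliftP => [k ->|->] /=.
  by rewrite (big_pred1 k) // => l; rewrite (inj_eq lift_inj).
by rewrite big_pred0 // => l; rewrite eq_sym (negbTE (neq_lift _ _)).
Qed.

Lemma height_itv n (P : pred 'I_n.+1) (x : 'rV[R]_n.+1) :
  standard_simplex R n x -> (`[0, 1] : set R) (\sum_(k | P k) x 0 k).
Proof.
move=> [x_ge0 x1]; rewrite /= in_itv /= sumr_ge0 //= -x1.
by rewrite [leRHS](bigID P) /= lerDl sumr_ge0.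
Qed.

Definition height_fun n (P : pred 'I_n.+1) (x : standard_simplex R n) :
    (`[0, 1] : set R) :=
  exist _ (\sum_(k | P k) (val x) 0 k) (mem_set (height_itv P (set_valP x))).

Lemma height_continuous n (P : pred 'I_n.+1) : continuous (height_fun P).
Proof.
apply: (@continuous_comp_initial _ _ _ set_val (height_fun P)) => x.
apply: (@continuous_comp _ _ _ set_val
  (fun y : 'rV_n.+1 => \sum_(k | P k) y 0 k)).
  exact: initial_continuous.
exact: sum_coord_continuous.
Qed.

(** The affine function on the simplex with value 1 at the vertices in P and 0
at the others. *)
Definition height n (P : pred 'I_n.+1) :
    continuousType (standard_simplex R n) (`[0, 1] : set R) :=
  mkcts (@height_continuous n P).

Lemma height_push m n (f : 'I_m.+1 -> 'I_n.+1) P x :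
  height P (push f x) = height (P \o f) x.
Proof. by apply: val_inj; rewrite /= sum_push_row. Qed.

End AffineMaps.

(** * The prism operator *)

(** The cancellation behind the boundary formula of the prism operator. Here
a i j stands for the j-th face of the i-th simplex of a prism, and b i j for the
i-th simplex of the prism over the j-th face of the base. The faces with j < i
or j > i + 1, once reindexed, are the b i j with the opposite sign. The two
remaining faces a i i and a i i.+1 of each simplex are the walls that separate
it from its neighbours: their sum telescopes to the two ends of the prism. *)
Lemma alternating_prism_sum (K : pzRingType) (V : lmodType K) q
    (a b : nat -> nat -> V) :
  (forall i j, j <= i -> i < q -> a i.+1 j = b i j)%N ->
  (forall i j, i < j -> j <= q -> a i j.+1 = b i j)%N ->
  (forall i, i < q -> a i i.+1 = a i.+1 i.+1)%N ->
  \sum_(i < q.+1) \sum_(j < q.+2) (-1) ^+ (i + j)%N *: a i j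
  + \sum_(j < q.+1) \sum_(i < q) (-1) ^+ (i + j)%N *: b i j
  = a 0 0 - a q q.+1.
Proof.
move=> a_low a_high a_diag.
pose B m n i := \sum_(m <= j < n) (-1) ^+ (i + j)%N *: b i j.
have sgnS i j (v : V) : (-1) ^+ (i + j).+1 *: v = - ((-1) ^+ (i + j)%N *: v).
  by rewrite exprS mulN1r scaleNr.
(* Row i splits at the two walls j = i and j = i + 1. *)
have row i : (i <= q)%N ->
    \sum_(j < q.+2) (-1) ^+ (i + j)%N *: a i j =
    \sum_(0 <= j < i) (-1) ^+ (i + j)%N *: a i j + (a i i - a i i.+1)
    - B i.+1 q.+1 i.
  move=> iq; rewrite -(big_mkord xpredT (fun j => (-1) ^+ (i + j)%N *: a i j)).
  rewrite (big_cat_nat _ (n := i)) ?(leq_trans iq _) ?leqW //=.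
  rewrite (@big_ltn _ _ _ i) ?ltnS ?leqW // (@big_ltn _ _ _ i.+1) ?ltnS //.
  rewrite -addrA addnS sgnS addnn -signr_odd odd_double expr0 !scale1r.
  rewrite -addrA; congr (_ + (_ + (_ + _))).
  rewrite big_add1 /= -sumrN; apply: eq_big_nat => j /andP[ij jq].
  by rewrite addnS sgnS a_high // -ltnS.
rewrite [X in _ + X]exchange_big /=.
under [X in X + _]eq_bigr => i _ do rewrite row ?leq_ord //.
rewrite big_split /= big_split /= sumrN.
have -> : \sum_(i < q.+1) (a i i - a i i.+1) = a 0 0 - a q q.+1.
  rewrite sumrB [X in X - _]big_ord_recl [X in _ - X]big_ord_recr /=.
  rewrite (eq_bigr _ (fun (i : 'I_q) _ => a_diag i (ltn_ord i))).
  by rewrite opprD addrACA addrA subrK.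
rewrite [X in X + _ - _]big_ord_recl big_nil add0r.
rewrite [X in _ - X + _]big_ord_recr /=.
rewrite {2}/B big_geq // addr0.
(* Below the walls, row 0 is empty and row i + 1 gives minus the part
   j <= i of row i of b; above them, row q is empty and row i gives minus the part
   j > i of row i of b. *)
have -> : \sum_(i < q) \sum_(0 <= j < i.+1) (-1) ^+ (i.+1 + j)%N *: a i.+1 j =
    - \sum_(i < q) B 0 i.+1 i.
  rewrite -sumrN; apply: eq_bigr => i _; rewrite -sumrN.
  by apply: eq_big_nat => j /andP[_ ji]; rewrite addSn sgnS a_low.
have -> : \sum_(i < q) \sum_(j < q.+1) (-1) ^+ (i + j)%N *: b i j =
    \sum_(i < q) B 0 i.+1 i + \sum_(i < q) B i.+1 q.+1 i.
  rewrite -big_split /=; apply: eq_bigr => i _.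
  rewrite -(big_mkord xpredT (fun j => (-1) ^+ (i + j)%N *: b i j)).
  by rewrite (big_cat_nat _ (n := i.+1)) //= ltnS ltnW.
set L := \sum_(i < q) B 0 _ _; set U := \sum_(i < q) B _ q.+1 _.
by rewrite -addrA [L + U]addrC addKr addrAC addNr add0r.
Qed.

Section Prism.
Context (R : realType) (K : fieldType) (T T' : topologicalType).
Context (h : continuousType ((`[0, 1] : set R) * T)%type T').

Section PrismSimplex.
Context q (s : singular_simplex R T q).

Definition homotopy_fun m (f : 'I_m.+1 -> 'I_q.+1) (P : pred 'I_m.+1)
  (x : standard_simplex R m) : T' := h (height R P x, s (push R f x)).

Lemma homotopy_fun_continuous m (f : 'I_m.+1 -> 'I_q.+1) P :
  continuous (@homotopy_fun m f P).
Proof.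
have cs : continuous (s \o push R f) by move=> y; apply: cts_fun.
move=> x.
apply: (@continuous_comp _ _ _ (fun y => (height R P y, s (push R f y)))).
  exact: cvg_pair (@cts_fun _ _ (height R P) x) (cs x).
exact: cts_fun.
Qed.

Definition homotopy_simplex m (f : 'I_m.+1 -> 'I_q.+1) (P : pred 'I_m.+1) :
    singular_simplex R T' m :=
  mkcts (@homotopy_fun_continuous m f P).

Lemma homotopy_simplexE m (f : 'I_m.+1 -> 'I_q.+1) P x :
  homotopy_simplex f P x = h (height R P x, s (push R f x)).
Proof. by []. Qed.

Lemma eq_homotopy_simplex m (f g : 'I_m.+1 -> 'I_q.+1) (P Q : pred 'I_m.+1) :
  f =1 g -> P =1 Q -> homotopy_simplex f P = homotopy_simplex g Q.
Proof. by move=> /funext -> /funext ->. Qed.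

Lemma homotopy_simplex_face m (f : 'I_m.+2 -> 'I_q.+1) P j :
  homotopy_simplex f P \o face R j =
  homotopy_simplex (f \o lift j) (P \o lift j) :> singular_simplex R T' m.
Proof.
apply/continuousEP => x.
rewrite -[LHS]/(homotopy_simplex f P (face R j x)) !homotopy_simplexE.
by rewrite face_push push_comp height_push.
Qed.

(** [unbump i] repeats the vertex i: its values are 0, ..., i, i, ..., q. So
this is h applied to the simplex of the prism with vertices 0, ..., i at the
bottom followed by i, ..., q at the top. *)
Definition prism_simplex i : singular_simplex R T' q.+1 :=
  homotopy_simplex (fun k : 'I_q.+2 => inord (unbump i k)) (fun k => i < k)%N.

End PrismSimplex.

Lemma face_homotopy_simplex q (s : singular_simplex R T q.+1) j m
    (f : 'I_m.+1 -> 'I_q.+1) P :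
  homotopy_simplex (s \o face R j : singular_simplex R T q) f P =
  homotopy_simplex s (lift j \o f) P.
Proof.
apply/continuousEP => x.
rewrite !homotopy_simplexE -[_ (push R f x)]/(s (face R j (push R f x))).
by rewrite face_push push_comp.
Qed.

Definition prism q : chain R K T q -> chain R K T' q.+1 :=
  fglift (fun s => \sum_(i < q.+1) (-1) ^+ i *: << prism_simplex s i >>).

HB.instance Definition _ q := GRing.Linear.on (@prism q).

Lemma prism1 q (s : singular_simplex R T q) :
  prism << s >> = \sum_(i < q.+1) (-1) ^+ i *: << prism_simplex s i >>.
Proof. exact: fglift1. Qed.

Lemma boundary1 (U : topologicalType) q (s : singular_simplex R U q.+1) :
  boundary << s >> = \sum_(i < q.+2)
    (-1) ^+ i *: << (s \o face R i : singular_simplex R U q) >>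
  :> chain R K U q.
Proof. exact: fglift1. Qed.

Context (f0 f1 : continuousType T T').
Hypothesis h0 : forall t x, val t = 0 -> h (t, x) = f0 x.
Hypothesis h1 : forall t x, val t = 1 -> h (t, x) = f1 x.

Lemma homotopy_simplex0 q (s : singular_simplex R T q) :
  homotopy_simplex s id xpred0 = f0 \o s :> singular_simplex R T' q.
Proof.
apply/continuousEP => x; rewrite homotopy_simplexE push_id h0 //.
by rewrite /= big_pred0.
Qed.

Lemma homotopy_simplex1 q (s : singular_simplex R T q) :
  homotopy_simplex s id xpredT = f1 \o s :> singular_simplex R T' q.
Proof.
apply/continuousEP => x; rewrite homotopy_simplexE push_id h1 //.
by have [] := set_valP x.
Qed.

Lemma boundary_prism_simplices q (s : singular_simplex R T q) :
  boundary (prism << s >>) = \sum_(i < q.+1) \sum_(j < q.+2)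
    (-1) ^+ (i + j)%N *: << homotopy_simplex s
      (fun k : 'I_q.+1 => inord (unbump i (bump j k)))
      (fun k => i < bump j k)%N >> :> chain R K T' q.
Proof.
rewrite prism1 linear_sum; apply: eq_bigr => i _.
rewrite linearZ /= boundary1 scaler_sumr; apply: eq_bigr => j _.
by rewrite scalerA -exprD homotopy_simplex_face.
Qed.

Lemma prism_boundary_simplices q (s : singular_simplex R T q.+1) :
  prism (boundary << s >>) = \sum_(j < q.+2) \sum_(i < q.+1)
    (-1) ^+ (i + j)%N *: << homotopy_simplex s
      (fun k : 'I_q.+2 => inord (bump j (unbump i k)))
      (fun k => i < k)%N >> :> chain R K T' q.+1.
Proof.
rewrite boundary1 linear_sum; apply: eq_bigr => j _.
rewrite linearZ /= prism1 scaler_sumr; apply: eq_bigr => i _.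
rewrite scalerA -exprD addnC /prism_simplex face_homotopy_simplex.
congr (_ *: << _ >>).
apply: eq_homotopy_simplex => // k; apply: val_inj => /=.
rewrite !inordK //; have := ltn_ord k; have := ltn_ord i; have := ltn_ord j;
  rewrite /bump /unbump; lia.
Qed.

(** The sum over b stands for the prism over the boundary of s. That boundary
makes sense only in positive degree, whereas the double sum is empty when q is
0; with b abstract, one cancellation serves both cases. *)
Lemma boundary_prism_ends q (s : singular_simplex R T q)
    (b : nat -> nat -> chain R K T' q) :
  (forall i j, i < q -> j <= q -> b i j = << homotopy_simplex s
      (fun k : 'I_q.+1 => inord (bump j (unbump i k)))
      (fun k => i < k)%N >>)%N ->
  boundary (prism << s >>)
  + \sum_(j < q.+1) \sum_(i < q) (-1) ^+ (i + j)%N *: b i j =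
  chain_map f1 << s >> - chain_map f0 << s >> :> chain R K T' q.
Proof.
move=> bE; pose a i j : chain R K T' q := << homotopy_simplex s
  (fun k : 'I_q.+1 => inord (unbump i (bump j k))) (fun k => i < bump j k)%N >>.
rewrite boundary_prism_simplices (@alternating_prism_sum _ _ q a b).
- (* The face 0 of the first simplex is the top, the last face of the last one
     is the bottom. *)
  rewrite !chain_map1 -homotopy_simplex0 -homotopy_simplex1.
  congr (<< _ >> - << _ >>); apply: eq_homotopy_simplex => k.
  + apply: val_inj; rewrite /= inordK; have := ltn_ord k;
      rewrite /bump /unbump; lia.
  + by rewrite /bump; lia.
  + apply: val_inj; rewrite /= inordK; have := ltn_ord k;
      rewrite /bump /unbump; lia.
  + by have := ltn_ord k; rewrite /bump; lia.
- move=> i j ji iq; rewrite bE; [|lia..].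
  congr (<< _ >>); apply: eq_homotopy_simplex => k;
    rewrite /bump /unbump; last lia.
  by congr inord; lia.
- move=> i j ij jq; rewrite bE; [|lia..].
  congr (<< _ >>); apply: eq_homotopy_simplex => k;
    rewrite /bump /unbump; last lia.
  by congr inord; lia.
- move=> i iq.
  congr (<< _ >>); apply: eq_homotopy_simplex => k;
    rewrite /bump /unbump; last lia.
  by congr inord; lia.
Qed.

Lemma boundary_prism0 (c : chain R K T 0) :
  boundary (prism c) = chain_map f1 c - chain_map f0 c.
Proof.
move: c; apply: freeg_linear_ext => [a u v|a u v|s].
- by rewrite !linearP.
- by rewrite !linearP /= scalerDr addrACA.
rewrite -(@boundary_prism_ends _ _ (fun _ _ => 0)) // big1 ?addr0 // => j _.
by rewrite big_ord0.
Qed.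

Lemma boundary_prismS q (c : chain R K T q.+1) :
  boundary (prism c) + prism (boundary c) = chain_map f1 c - chain_map f0 c.
Proof.
move: c; apply: freeg_linear_ext => [a u v|a u v|s].
- by rewrite !linearP /= scalerDr addrACA.
- by rewrite !linearP /= scalerDr addrACA.
rewrite prism_boundary_simplices.
exact: (boundary_prism_ends (b := fun i j => << homotopy_simplex s
  (fun k : 'I_q.+2 => inord (bump j (unbump i k))) (fun k => i < k)%N >>)).
Qed.

Context (A : set T) (A' : set T').
Hypothesis hA : forall t x, A x -> A' (h (t, x)).

(** This is where the homotopy has to be one of pairs: it makes the prism
operator descend to the quotient by the chains of the subspaces. *)
Lemma chain_in_prism q (c : chain R K T q) :
  chain_in A c -> chain_in A' (prism c).
Proof.
rewrite -[X in prism X]freeg_sumE linear_sum => Ac.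
have : {subset dom c <= dom c} by [].
elim: {1 3}(dom c) => [|s l IHl] sub.
  by rewrite big_nil; exact: chain_in0.
rewrite big_cons freegUE linearZ /= prism1; apply: chain_inP; last first.
  by apply: IHl => s' s'l; apply: sub; rewrite in_cons s'l orbT.
elim/big_ind: _ => [|u v Au Av|i _]; first exact: chain_in0.
  by rewrite -[u]scale1r; exact: chain_inP.
rewrite -[_ *: _]addr0; apply: chain_inP; last exact: chain_in0.
move=> s'; rewrite domU1 inE => /eqP -> _ [x _ <-].
apply: hA; apply: (Ac s); last by eexists.
by apply: sub; rewrite mem_head.
Qed.

(** On a cycle c relative to A, the images of c under the two ends differ by
the boundary of its prism and the prism of its boundary. The latter lies in A',
as the boundary of c lies in A, and is absent in degree 0. *)
Lemma reduced_homology_map_homotopic (f0A : f0 @` A `<=` A')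
    (f1A : f1 @` A `<=` A') q :
  reduced_homology_map R K f0 f0A q =1 reduced_homology_map R K f1 f1A q.
Proof.
move=> z; rewrite -[z]quot_reprK /reduced_homology_map /= !quot_map_pi.
apply/esym/quot_pi_eqP/asboolP.
case: q z => [|q] z; set c := quot_repr z.
  exists (prism (c : chain R K T 0)), 0; first exact: chain_in0.
  by rewrite addr0 boundary_prism0.
exists (prism (c : chain R K T q.+1)).
exists (prism (boundary (c : chain R K T q.+1))).
  by apply: chain_in_prism; have /asboolP := reduced_cycleP c.
by rewrite boundary_prismS.
Qed.

End Prism.

(** * From homological to homotopical linking *)

Section Linking.

Lemma reduced_homology_map_eq0 (R : realType) (K : fieldType)
    (T T' : topologicalType) (A : set T) (A' : set T') (f : continuousType T T')
    (fA : f @` A `<=` A') q z :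
  range f `<=` A' -> reduced_homology_map R K f fA q z = 0.
Proof.
move=> fT; rewrite -[z]quot_reprK /reduced_homology_map /= quot_map_pi.
apply/eqP; rewrite quot_pi_eq0; apply/asboolP.
set c := quot_repr z.
exists 0, (chain_map f (c : chain R K T q)); last by rewrite linear0 add0r.
by apply: (chain_in_map (A := setT)) => // s _ x _.
Qed.

Context (R : realType) (X : topologicalType) (B D : set X) (eta : R * X -> X).
Hypothesis eta_cont : {within (`[0, 1] `*` B), continuous eta}.
Hypothesis etaD : forall t x, (`[0, 1] : set R) t -> B x -> D (eta (t, x)).

(** A map on R * X that is only continuous within [0, 1] * B becomes an honest
continuous map once it is restricted to the product of the subspaces. *)
Definition homotopy_within_fun (p : (`[0, 1] : set R) * B) : D :=
  exist _ (eta (val p.1, val p.2))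
    (mem_set (etaD (set_valP p.1) (set_valP p.2))).

Lemma homotopy_within_continuous : continuous homotopy_within_fun.
Proof.
apply: (@continuous_comp_initial _ _ _ set_val homotopy_within_fun) => -[t x].
pose g (p : (`[0, 1] : set R) * B) := (val p.1, val p.2) : R * X.
have gB p : (`[0, 1] `*` B) (g p) by split; exact: set_valP.
have g1_cont : continuous (fun p : (`[0, 1] : set R) * B => set_val p.1).
  move=> p; apply: (@continuous_comp _ _ _ fst set_val); first exact: cvg_fst.
  exact: initial_continuous.
have g2_cont : continuous (fun p : (`[0, 1] : set R) * B => set_val p.2).
  move=> p; apply: (@continuous_comp _ _ _ snd set_val); first exact: cvg_snd.
  exact: initial_continuous.
have g_cont : g p @[p --> (t, x)] --> g (t, x) :=
  cvg_pair (g1_cont (t, x)) (g2_cont (t, x)).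
have eta_g := (subspace_continuousP _ _).1 eta_cont _ (gB (t, x)).
move=> U /eta_g /g_cont.
by apply: (@filterS _ _ (nbhs_filter (t, x))) => p; exact.
Qed.

Definition homotopy_within :
    continuousType ((`[0, 1] : set R) * B)%type D :=
  mkcts homotopy_within_continuous.

Lemma slice_continuous (t : (`[0, 1] : set R)) :
  continuous (fun x : B => homotopy_within (t, x)).
Proof.
move=> x; apply: (@continuous_comp _ _ _ (fun y : B => (t, y)) homotopy_within).
  exact: cvg_pair (cvg_cst t) (@cvg_id _ (nbhs x)).
exact: cts_fun.
Qed.

End Linking.

Theorem corollary2p2 (R : realType) (K : fieldType) (X : topologicalType)
    (B A Q P : set X) (hAB : A `<=` B) (hPQ : P `<=` Q)
    (hBP : B `&` P = set0) (hAQ : A `&` Q = set0)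
    (hlink : homologically_links R K B A Q P) :
  homotopically_links R B A Q P.
Proof.
move=> eta [eta_cont eta0] etaA eta1Q; apply: contrapT => etaP.
have [BP [AQ [q [z]]]] := hlink; apply/negP; rewrite negbK.
(* The linking condition concerns the times t > 0; at t = 0 the deformation
   avoids P since B does. *)
have etaD t x : (`[0, 1] : set R) t -> B x -> (~` P) (eta (t, x)).
  rewrite /= in_itv /= le_eqVlt => /andP[/predU1P[<- _|t0 t1] Bx Px].
    by move: Px; rewrite eta0 //; exact: BP.
  apply: etaP; exists t; first by rewrite in_itv /= t0.
  by exists (eta (t, x)); split => //; exists x.
have one01 : (`[0, 1] : set R) 1 by rewrite /= in_itv /= ler01 lexx.
pose t1 : (`[0, 1] : set R) := exist _ 1 (mem_set one01).
pose f1 : continuousType B (~` P) :=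
  mkcts (@slice_continuous _ _ _ _ _ eta_cont etaD t1).
have f1Q : range f1 `<=` val @^-1` (~` Q).
  move=> _ [x _ <-] Qx; rewrite -[False]/(set0 (eta (1, val x))) -eta1Q.
  by split => //; exists (val x) => //; exact: set_valP.
have f1A : f1 @` (val @^-1` A) `<=` val @^-1` (~` Q).
  by move=> y [x _ <-]; apply: f1Q; exists x.
apply/eqP; rewrite -(reduced_homology_map_eq0 (f := f1) f1A z f1Q).
apply: (@reduced_homology_map_homotopic _ _ _ _ (homotopy_within eta_cont etaD)).
- move=> t x t0; apply: val_inj; rewrite /= t0 eta0 //; exact: set_valP.
- by move=> t x t1E; apply: val_inj; rewrite /= t1E.
- move=> t x Ax; rewrite /= etaA //; [exact: AQ|exact: (set_valP t)].
Qed.
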